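(* (Second Separation Theorem) Let $\mathbf P=(P,\leq,{}',0,1)$ be a distributive complemented poset with antitone complementation satisfying the Descending Chain Condition, and let $I$ be an ideal and $F$ an ultrafilter of $\mathbf P$. Then there exists some $g\in F$ with $U(g)=F$. Now assume that (for this $g$) the meet $x\wedge g$ exists for every $x\in P\setminus F$ and that $I\cap F=\emptyset$. Then there exists some c-ideal $J$ of $\mathbf P$ with $I\subseteq J$ and $J\cap F=\emptyset$.
   Context: For a poset $(P,\leq)$ and $A\subseteq P$ put $L(A)=\{x\in P\mid x\leq y\text{ for all }y\in A\}$ and $U(A)=\{x\in P\mid y\leq x\text{ for all }y\in A\}$; write $L(a)=L(\{a\})$, $L(a,b)=L(\{a,b\})$, $L(A,a)=L(A\cup\{a\})$, $L(A,B)=L(A\cup B)$, $LU(A)=L(U(A))$, and similarly with $U$ in place of $L$. A complemented poset $\mathbf P=(P,\leq,{}',0,1)$ is a bounded poset (bottom $0$, top $1$) with a unary operation ${}'$ (the complementation) such that for every $x\in P$ the join $x\vee x'$ and the meet $x\wedge x'$ exist and $x\vee x'=1$, $x\wedge x'=0$. The operation ${}'$ is antitone if $x\leq y$ implies $y'\leq x'$. The poset $(P,\leq)$ is distributive if it satisfies one of the following equivalent conditions: $L\big(U(x,y),z\big)=LU\big(L(x,z),L(y,z)\big)$ for all $x,y,z\in P$; $U\big(L(x,y),z\big)=UL\big(U(x,z),U(y,z)\big)$ for all $x,y,z\in P$. $\mathbf P$ satisfies the Descending Chain Condition if it has no infinite descending chains. For $A\subseteq P$ put $A_0=\{x\in P\mid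 x'\in A\}$. A non-empty subset $I$ of $P$ is an ideal of $\mathbf P$ if $L(x)\subseteq I$ and $U(x,y)\cap I\neq\emptyset$ for all $x,y\in I$. A non-empty subset $F$ of $P$ is a filter of $\mathbf P$ if $U(x)\subseteq F$ and $L(x,y)\cap F\neq\emptyset$ for all $x,y\in F$. A filter $F$ is proper if $F\neq P$, and an ultrafilter is a maximal (with respect to inclusion) proper filter. An ideal $J$ of $\mathbf P$ is a c-ideal if there exists some filter $G$ of $\mathbf P$ with $G_0=J$. *)

(* Defs.v *)
From mathcomp Require Import all_boot all_order.
From mathcomp Require Import boolp classical_sets.

Set Implicit Arguments.
Unset Strict Implicit.
Unset Printing Implicit Defensive.

Import Order.TTheory.
Local Open Scope order_scope.
Local Open Scope classical_set_scope.

(* L(A) and U(A) are lbound A and ubound A; "z is the join (meet) of x and y"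
   is supremums [set x; y] z (infimums [set x; y] z). *)

Section PosetNotions.
Context {d : Order.disp_t} {P : porderType d}.
Implicit Types (x y z : P) (I F G J : set P).

Definition distributive_poset (Q : porderType d) : Prop :=
  forall x y z : Q,
    lbound (ubound [set x; y] `|` [set z]) =
    lbound (ubound (lbound [set x; z] `|` lbound [set y; z])).

Definition dual_distributive_poset (Q : porderType d) : Prop :=
  forall x y z : Q,
    ubound (lbound [set x; y] `|` [set z]) =
    ubound (lbound (ubound [set x; z] `|` ubound [set y; z])).

Definition descending_chain_condition (Q : porderType d) : Prop :=
  ~ exists f : nat -> Q, forall n : nat, f n.+1 < f n.

Definition poset_ideal I : Prop :=
  I !=set0 /\
  forall x y, I x -> I y ->
    lbound [set x] `<=` I /\ ubound [set x; y] `&` I !=set0.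

Definition poset_filter F : Prop :=
  F !=set0 /\
  forall x y, F x -> F y ->
    ubound [set x] `<=` F /\ lbound [set x; y] `&` F !=set0.

Definition proper_poset_filter F : Prop := poset_filter F /\ F <> setT.

Definition poset_ultrafilter F : Prop :=
  proper_poset_filter F /\
  forall G, proper_poset_filter G -> F `<=` G -> G = F.

(* The preimage of G under the complementation is the set written G_0. *)
Definition c_ideal (compl : P -> P) J : Prop :=
  poset_ideal J /\ exists G, poset_filter G /\ compl @^-1` G = J.

End PosetNotions.

Definition complementation {d : Order.disp_t} {P : tbPOrderType d}
    (compl : P -> P) : Prop :=
  forall x, supremums [set x; compl x] \top /\ infimums [set x; compl x] \bot.

Definition antitone {d : Order.disp_t} {P : porderType d}
    (compl : P -> P) : Prop :=
  forall x y : P, x <= y -> compl y <= compl x.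

Lemma distributive_poset_dual (d : Order.disp_t) (P : porderType d) :
  distributive_poset P <-> dual_distributive_poset P.
Proof.
split=> D x y z; apply/seteqP; split=> u hu.
- move=> w hw.
  have hwx v : z <= v -> x <= v -> w <= v.
    by move=> zv xv; apply: hw; left=> t [->|->].
  have hwy v : z <= v -> y <= v -> w <= v.
    by move=> zv yv; apply: hw; right=> t [->|->].
  have zu : z <= u by apply: hu; right.
  have := D x z w; move=> /(congr1 (@^~ w)) /= e.
  have : lbound (ubound [set x; z] `|` [set w]) w.
    by move=> v [hv|->//]; apply: hwx; apply: hv; [right|left].
  rewrite e; apply => v [] hv; last first.
    by apply: le_trans zu; apply: hv; left.
  have vx : v <= x by apply: hv; left.
  have vw : v <= w by apply: hv; right.
  have := D y z v; move=> /(congr1 (@^~ v)) /= e'.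
  have : lbound (ubound [set y; z] `|` [set v]) v.
    move=> t [ht|->//]; apply: (le_trans vw); apply: hwy; apply: ht.
      by right.
    by left.
  rewrite e'; apply => t [] ht; last by apply: le_trans zu; apply: ht; left.
  apply: hu; left=> s [->|->]; last by apply: ht; left.
  by apply: le_trans vx; apply: ht; right.
- move=> v [hv|->]; apply: hu => t [] ht.
  + by apply: (@le_trans _ _ x); [apply: hv; left|apply: ht; left].
  + by apply: (@le_trans _ _ y); [apply: hv; right|apply: ht; left].
  + by apply: ht; right.
  + by apply: ht; right.
- move=> w hw.
  have hwx v : v <= z -> v <= x -> v <= w.
    by move=> zv xv; apply: hw; left=> t [->|->].
  have hwy v : v <= z -> v <= y -> v <= w.
    by move=> zv yv; apply: hw; right=> t [->|->].
  have zu : u <= z by apply: hu; right.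
  have := D x z w; move=> /(congr1 (@^~ w)) /= e.
  have : ubound (lbound [set x; z] `|` [set w]) w.
    by move=> v [hv|->//]; apply: hwx; apply: hv; [right|left].
  rewrite e; apply => v [] hv; last first.
    by apply: (le_trans zu); apply: hv; left.
  have vx : x <= v by apply: hv; left.
  have vw : w <= v by apply: hv; right.
  have := D y z v; move=> /(congr1 (@^~ v)) /= e'.
  have : ubound (lbound [set y; z] `|` [set v]) v.
    move=> t [ht|->//]; apply: le_trans vw; apply: hwy; apply: ht.
      by right.
    by left.
  rewrite e'; apply => t [] ht; last by apply: (le_trans zu); apply: ht; left.
  apply: hu; left=> s [->|->]; last by apply: ht; left.
  by apply: (le_trans vx); apply: ht; right.
- move=> v [hv|->]; apply: hu => t [] ht.
  + by apply: (@le_trans _ _ x); [apply: ht; left|apply: hv; left].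
  + by apply: (@le_trans _ _ y); [apply: ht; left|apply: hv; right].
  + by apply: ht; right.
  + by apply: ht; right.
Qed.

(* Main.v *)
Require Import Defs.
From mathcomp Require Import all_boot all_order.
From mathcomp Require Import boolp classical_sets.

Set Implicit Arguments.
Unset Strict Implicit.
Unset Printing Implicit Defensive.

Import Order.TTheory.
Local Open Scope order_scope.
Local Open Scope classical_set_scope.

(** The descending chain condition gives [F] a minimal element [g], and a
    minimal element of a down-directed set is its least element, so [F] is the
    principal filter [U(g)] ([poset_filter_principal]).  Maximality of [F]
    makes [g] an atom ([principal_ultrafilter_atom]).  Hence if [x] is not in
    [F], then [x] and [g] have no common lower bound but [\bot], and
    distributivity turns this into [x <= compl g]
    ([disjoint_le_codisjoint]).  Every ideal disjoint from [F] is therefore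
    contained in [J := L(compl g)], and [J] misses [F] because [g] and
    [compl g] meet in [\bot].  Finally the complementation is an involution,
    complements being unique ([complementationK]), so that [x <= compl g] is
    equivalent to [g <= compl x]: the ideal [J] is the preimage of [F] under
    [compl], hence a c-ideal. *)

Lemma descending_chain_condition_min (d : Order.disp_t) (P : porderType d)
    (A : set P) :
  descending_chain_condition P -> A !=set0 ->
  exists2 g, A g & forall x, A x -> ~ x < g.
Proof.
move=> dcc [a Aa]; apply: contrapT => nomin; apply: dcc.
have desc (u : {x | A x}) : exists v : {x | A x}, sval v < sval u.
  case: u => u Au /=; apply: contrapT => noless; apply: nomin.
  by exists u => // x Ax xu; apply: noless; exists (exist _ x Ax).
have [f fP] := choice desc.
by exists (fun n => sval (iter n f (exist _ a Aa))) => n; exact: fP.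
Qed.

Lemma poset_filter_principal (d : Order.disp_t) (P : porderType d)
    (F : set P) :
  descending_chain_condition P -> poset_filter F ->
  exists2 g, F g & ubound [set g] = F.
Proof.
move=> dcc [F0 Ffil]; have [g Fg gmin] := descending_chain_condition_min dcc F0.
exists g => //; apply/seteqP; split=> [|y Fy]; first by case: (Ffil g g Fg Fg).
have [_ [z [zL Fz]]] := Ffil g y Fg Fy.
have zg : z <= g by apply: zL; left.
have zy : z <= y by apply: zL; right.
move: zg; rewrite le_eqVlt => /orP[/eqP gz|/(gmin _ Fz)//].
by move=> _ ->; rewrite -gz.
Qed.

Lemma poset_filter_ubound1 (d : Order.disp_t) (P : porderType d) (a : P) :
  poset_filter (ubound [set a]).
Proof.
split=> [|x y ax ay]; first by exists a => _ ->.
split=> [z xz _ ->|]; first exact: le_trans (ax _ erefl) (xz _ erefl).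
exists a; split=> [_ [->|->]|_ -> //]; [exact: ax|exact: ay].
Qed.

Lemma poset_ideal_lbound1 (d : Order.disp_t) (P : porderType d) (a : P) :
  poset_ideal (lbound [set a]).
Proof.
split=> [|x y xa ya]; first by exists a => _ ->.
split=> [z zx _ ->|]; first exact: le_trans (zx _ erefl) (xa _ erefl).
exists a; split=> [_ [->|->]|_ -> //]; [exact: xa|exact: ya].
Qed.

Lemma principal_ultrafilter_atom (d : Order.disp_t) (P : tbPOrderType d)
    (g : P) :
  poset_ultrafilter (ubound [set g]) ->
  g <> \bot /\ forall a, a <= g -> a <> \bot -> a = g.
Proof.
move=> [[_ gproper] gmax]; split=> [g0|a ag a0].
  by apply: gproper; apply/seteqP; split=> // x _ _ ->; rewrite g0 le0x.
have aproper : ubound [set a] <> setT.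
  move=> aT; apply: a0; apply/le_anti; rewrite le0x andbT.
  have : ubound [set a] \bot by rewrite aT.
  exact.
have ga : ubound [set g] `<=` ubound [set a].
  by move=> x gx _ ->; exact: le_trans ag (gx _ erefl).
have eq_ag := gmax _ (conj (poset_filter_ubound1 a) aproper) ga.
have Ua : ubound [set g] a by rewrite -eq_ag => _ ->.
by apply/le_anti; rewrite ag; exact: Ua.
Qed.

(** In a bounded distributive poset, [x] lies below [z] as soon as some [y]
    satisfies [L(x, y) = {\bot}] and [U(y, z) = {\top}]. *)
Lemma disjoint_le_codisjoint (d : Order.disp_t) (P : tbPOrderType d)
    (x y z : P) :
  distributive_poset P ->
  (forall w, w <= x -> w <= y -> w = \bot) ->
  (forall w, y <= w -> z <= w -> w = \top) ->
  x <= z.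
Proof.
move=> distr disj codisj.
have : lbound (ubound [set y; z] `|` [set x]) x.
  move=> w [wU|-> //]; have -> : w = \top; last exact: lex1.
  by apply: codisj; apply: wU; [left|right].
rewrite distr; apply=> w [] wL; last by apply: wL; left.
by rewrite (disj w) ?le0x //; apply: wL; [right|left].
Qed.

Section Complementation.
Context {d : Order.disp_t} {P : tbPOrderType d} {compl : P -> P}.
Hypothesis hcompl : complementation compl.

Lemma complementation_disj (x w : P) : w <= x -> w <= compl x -> w = \bot.
Proof.
move=> wx wc; apply/le_anti; rewrite le0x andbT.
by have [_ [_]] := hcompl x; apply=> _ [->|->].
Qed.

Lemma complementation_codisj (x w : P) : x <= w -> compl x <= w -> w = \top.
Proof.
move=> xw cw; apply/le_anti; rewrite lex1.
by have [[_ topmin] _] := hcompl x; apply: topmin => _ [->|->].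
Qed.

Lemma complementationK (hdistr : distributive_poset P) (x : P) :
  compl (compl x) = x.
Proof.
(* Both elements are complements of [compl x]. *)
apply/le_anti/andP; split; apply: (@disjoint_le_codisjoint _ _ _ (compl x)) => // w.
- by move=> wcc wc; exact: complementation_disj wc wcc.
- by move=> cw xw; exact: complementation_codisj xw cw.
- exact: complementation_disj.
- exact: complementation_codisj.
Qed.

Lemma preimage_compl_ubound1 (hdistr : distributive_poset P)
    (hanti : antitone compl) (g : P) :
  compl @^-1` ubound [set g] = lbound [set compl g].
Proof.
apply/seteqP; split=> x /= xP _ ->.
  by rewrite -[x]complementationK //; apply: hanti; exact: xP.
by rewrite -[g]complementationK //; apply: hanti; exact: xP.
Qed.

End Complementation.

Theorem theorem20 (d : Order.disp_t) (P : tbPOrderType d) (compl : P -> P)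
    (hcompl : complementation compl) (hanti : antitone compl)
    (hdistr : distributive_poset P) (hDCC : descending_chain_condition P)
    (I F : set P) (hI : poset_ideal I) (hF : poset_ultrafilter F) :
  exists g : P,
    [/\ F g,
        ubound [set g] = F &
        (forall x : P, ~ F x -> exists m : P, infimums [set x; g] m) ->
        I `&` F = set0 ->
        exists J : set P, [/\ c_ideal compl J, I `<=` J & J `&` F = set0]].
Proof.
have [g Fg gF] := poset_filter_principal hDCC hF.1.1.
exists g; split=> // _ IF0.
have [g0 gatom] : g <> \bot /\ forall a, a <= g -> a <> \bot -> a = g.
  by apply: principal_ultrafilter_atom; rewrite gF.
exists (lbound [set compl g]); split.
- split; first exact: poset_ideal_lbound1.
  exists (ubound [set g]); split; first exact: poset_filter_ubound1.
  exact: preimage_compl_ubound1.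
- move=> x Ix _ ->.
  apply: (@disjoint_le_codisjoint _ _ _ g) => // [w wx wg|];
    last exact: complementation_codisj.
  apply: contrapT => w0.
  have : (I `&` F) x; last by rewrite IF0.
  by split=> //; rewrite -gF => _ ->; rewrite -(gatom w).
- rewrite -subset0 -gF => x [xc gx]; apply: g0.
  apply: (complementation_disj hcompl (lexx g)).
  exact: le_trans (gx _ erefl) (xc _ erefl).
Qed.
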